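(* Let $H_\mathbb{R}$ be the real Heisenberg group, realized as $\mathbb{R}^3$ with the law $(x,y,z)(x',y',z')=(x+x',\,y+y',\,z+z'+(xy'-x'y))$, and let $H_\mathbb{Z}=\mathbb{Z}^3\subset H_\mathbb{R}$, a lattice. Then for every countable subgroup $\Gamma$ of $\mathrm{Aff}_{H_\mathbb{Z}}(H_\mathbb{R})$, the action $\Gamma\curvearrowright H_\mathbb{R}/H_\mathbb{Z}$, with respect to the $H_\mathbb{R}$-invariant probability measure on $H_\mathbb{R}/H_\mathbb{Z}$, does not have the property (T) relative to the space.
   Context: Affine group. For a Lie group $G$ with lattice $\Lambda$, $\mathrm{Aut}_\Lambda(G)$ is the group of continuous automorphisms $\sigma$ of $G$ with $\sigma(\Lambda)=\Lambda$, and $\mathrm{Aff}_\Lambda(G)=G\rtimes\mathrm{Aut}_\Lambda(G)$ acts on $G/\Lambda$ by $(g,\sigma)\cdot x\Lambda=g\sigma(x)\Lambda$; this action preserves the $G$-invariant probability measure on $G/\Lambda$. Property (T) relative to the space. A measure preserving action $\Gamma\curvearrowright(X,\mu)$ of a countable group on a standard probability space has the property (T) relative to the space (also called rigidity in the sense of Popa, i.e. the inclusion $L^\infty(X)\subset L^\infty(X)\rtimes\Gamma$ has relative property (T)) if, equivalently, the following holds: for every sequence of Borel probability measures $\nu_n$ on $X\times X$ such that 1. $p^i_*\nu_n=\mu$ for all $n$ and $i=1,2$, where $p^i:X\times X\to X$ is the projection onto the $i$-th coordinate, 2. $\int_{X\times X}\phi(x)\psi(y)\,d\nu_n(x,y)\to\int_X\phi(x)\psi(x)\,d\mu(x)$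 for all bounded Borel functions $\phi,\psi$ on $X$, 3. $\|(\gamma\times\gamma)_*\nu_n-\nu_n\|\to 0$ (total variation norm) for every $\gamma\in\Gamma$, one has $\nu_n(\Delta_X)\to 1$, where $\Delta_X$ is the diagonal of $X\times X$. *)

(* Defs.v *)
From HB Require Import structures.
From mathcomp Require Import all_boot all_order all_algebra.
From mathcomp Require Import all_classical all_reals all_analysis.
From mathcomp Require Import ring.

Set Implicit Arguments.
Unset Strict Implicit.
Unset Printing Implicit Defensive.

Import Order.TTheory GRing.Theory Num.Theory.
Import numFieldNormedType.Exports.

Local Open Scope classical_set_scope.
Local Open Scope quotient_scope.
Local Open Scope group_scope.

HB.mixin Record isTopologicalGroup G of Group G & Topological G := {
  mulg_continuous : continuous (fun x : G * G => x.1 * x.2) ;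
  invg_continuous : continuous (fun x : G => x^-1) }.

#[short(type="topologicalGroupType")]
HB.structure Definition TopologicalGroup :=
  {G of isTopologicalGroup G & Group G & Topological G}.

Record subgroup (G : groupType) := Subgroup {
  subgroup_set :> set G ;
  subgroup1 : subgroup_set 1 ;
  subgroupM : forall x y, subgroup_set x -> subgroup_set y ->
    subgroup_set (x * y) ;
  subgroupV : forall x, subgroup_set x -> subgroup_set x^-1 }.

Section coset_relation.
Variables (G : groupType) (L : subgroup G).

Definition coset_rel : rel G := fun g h => `[< subgroup_set L (g^-1 * h) >].

Lemma coset_rel_refl : reflexive coset_rel.
Proof. by move=> g; apply/asboolP; rewrite mulVg; exact: subgroup1. Qed.

Lemma coset_rel_sym : symmetric coset_rel.
Proof.
have H g h : coset_rel g h -> coset_rel h g.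
  by move/asboolP/subgroupV; rewrite invgM invgK => ?; apply/asboolP.
by move=> g h; apply/idP/idP; exact: H.
Qed.

Lemma coset_rel_trans : transitive coset_rel.
Proof.
move=> h g k /asboolP gh /asboolP hk; apply/asboolP.
by have := subgroupM gh hk; rewrite mulgA mulgK.
Qed.

Canonical coset_equiv_rel :=
  EquivRel coset_rel coset_rel_refl coset_rel_sym coset_rel_trans.

End coset_relation.

(** [homspace L] is G/L, with the quotient topology. *)
Definition homspace (G : topologicalGroupType) (L : subgroup G) : Type :=
  quotient_topology {eq_quot coset_equiv_rel L}.

Section homspace.
Variables (G : topologicalGroupType) (L : subgroup G).
HB.instance Definition _ :=
  Topological.copy (homspace L) (quotient_topology {eq_quot coset_equiv_rel L}).
HB.instance Definition _ :=
  Quotient.copy (homspace L) (quotient_topology {eq_quot coset_equiv_rel L}).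
HB.instance Definition _ := isPointed.Build (homspace L) (\pi_(homspace L) 1).
End homspace.

Notation borel_homspace L := (g_sigma_algebraType (@open (homspace L))).

(** The inverse is stored so that the group operations are explicit; it is
    determined by [aut_fun].  Its continuity is required because G is an
    arbitrary topological group; for a Lie group it follows from that of
    [aut_fun]. *)
Record lat_aut (G : topologicalGroupType) (L : subgroup G) := LatAut {
  aut_fun :> G -> G ;
  aut_inv : G -> G ;
  aut_funK : cancel aut_fun aut_inv ;
  aut_invK : cancel aut_inv aut_fun ;
  autM : {morph aut_fun : x y / x * y} ;
  aut_fun_continuous : continuous aut_fun ;
  aut_inv_continuous : continuous aut_inv ;
  aut_lattice : aut_fun @` L = L }.

Section lat_aut.
Variables (G : topologicalGroupType) (L : subgroup G).
Implicit Types s t u : lat_aut L.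

Lemma lat_aut_eq s t : s =1 t -> s = t.
Proof.
case: s t => [f f' fK f'K fM fc f'c fL] [g g' gK g'K gM gc g'c gL] /= /funext E.
move: fK f'K fM fc f'c fL; rewrite E => fK f'K fM fc f'c fL.
have E' : f' = g' by apply/funext => x; rewrite -{1}(g'K x) fK.
move: fK f'K f'c; rewrite E' => fK f'K f'c.
by congr LatAut; exact: Prop_irrelevance.
Qed.

Definition lat_aut1 : lat_aut L.
Proof.
refine (@LatAut G L id id _ _ _ _ _ _) => //; last exact: image_id.
- by move=> x; exact: cvg_id.
- by move=> x; exact: cvg_id.
Defined.

Definition lat_autM s t : lat_aut L.
Proof.
refine (@LatAut G L (s \o t) (aut_inv t \o aut_inv s) _ _ _ _ _ _).
- by apply: can_comp; exact: aut_funK.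
- by apply: can_comp; exact: aut_invK.
- by move=> x y /=; rewrite !autM.
- move=> x; apply: continuous_comp; exact: aut_fun_continuous.
- move=> x; apply: continuous_comp; exact: aut_inv_continuous.
- by rewrite -image_comp !aut_lattice.
Defined.

Definition lat_autV s : lat_aut L.
Proof.
refine (@LatAut G L (aut_inv s) s _ _ _ _ _ _).
- exact: aut_invK.
- exact: aut_funK.
- move=> x y; apply: (can_inj (@aut_funK _ _ s)).
  by rewrite autM !aut_invK.
- exact: aut_inv_continuous.
- exact: aut_fun_continuous.
- rewrite -{1}(aut_lattice s) image_comp -[RHS]image_id.
  by apply: eq_imagel => x _ /=; rewrite aut_funK.
Defined.

HB.instance Definition _ := gen_eqMixin (lat_aut L).
HB.instance Definition _ := gen_choiceMixin (lat_aut L).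

Lemma lat_autA : associative lat_autM. Proof. by move=> s t u; exact: lat_aut_eq. Qed.
Lemma lat_aut1M : left_id lat_aut1 lat_autM. Proof. by move=> s; exact: lat_aut_eq. Qed.
Lemma lat_autM1 : right_id lat_aut1 lat_autM. Proof. by move=> s; exact: lat_aut_eq. Qed.
Lemma lat_autVM : left_inverse lat_aut1 lat_autV lat_autM.
Proof. by move=> s; apply: lat_aut_eq => x; exact: aut_funK. Qed.
Lemma lat_autMV : right_inverse lat_aut1 lat_autV lat_autM.
Proof. by move=> s; apply: lat_aut_eq => x; exact: aut_invK. Qed.

HB.instance Definition _ := isGroup.Build (lat_aut L)
  lat_autA lat_aut1M lat_autM1 lat_autVM lat_autMV.

Lemma lat_aut_fun1 s : s 1 = 1.
Proof. by apply: (@mulgI _ (s 1)); rewrite -autM !mulg1. Qed.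

Lemma lat_aut_funV s x : s x^-1 = (s x)^-1.
Proof. by apply: (@mulgI _ (s x)); rewrite -autM !mulgV lat_aut_fun1. Qed.

Lemma lat_aut_mem s x : subgroup_set L x -> subgroup_set L (s x).
Proof. by move=> Lx; rewrite -(aut_lattice s); exists x. Qed.

End lat_aut.

Definition aff (G : topologicalGroupType) (L : subgroup G) : Type :=
  (G * lat_aut L)%type.

Section aff.
Variables (G : topologicalGroupType) (L : subgroup G).
Implicit Types a b c : aff L.

HB.instance Definition _ := Choice.copy (aff L) (G * lat_aut L)%type.

Definition aff1 : aff L := (1, 1).
Definition affM a b : aff L := (a.1 * a.2 b.1, a.2 * b.2).
Definition affV a : aff L := (a.2^-1 (a.1^-1), a.2^-1).

Lemma affA : associative affM.
Proof. by move=> a b c; congr pair; rewrite /= ?autM mulgA. Qed.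
Lemma aff1M : left_id aff1 affM.
Proof. by case=> g s; congr pair; rewrite /= mul1g. Qed.
Lemma affM1 : right_id aff1 affM.
Proof. by case=> g s; congr pair; rewrite /= ?lat_aut_fun1 mulg1. Qed.
Lemma affVM : left_inverse aff1 affV affM.
Proof.
case=> g s; congr pair; last by rewrite /= mulVg.
by rewrite /= -[LHS](autM s^-1) mulVg lat_aut_fun1.
Qed.
Lemma affMV : right_inverse aff1 affV affM.
Proof.
case=> g s; congr pair; last by rewrite /= mulgV.
by rewrite /= [s _]aut_invK mulgV.
Qed.

HB.instance Definition _ := isGroup.Build (aff L) affA aff1M affM1 affVM affMV.

(** (g, s) . xL = g s(x) L; see [aff_act_pi]. *)
Definition aff_act a (x : homspace L) : homspace L :=
  \pi_(homspace L) (a.1 * a.2 (repr x)).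

Lemma homspace_eqP (g h : G) :
  \pi_(homspace L) g = \pi_(homspace L) h <-> subgroup_set L (g^-1 * h).
Proof.
have <- : (g == h %[mod {eq_quot coset_equiv_rel L}]) <->
    subgroup_set L (g^-1 * h).
  by rewrite eqmodE; split=> [/asboolP|/asboolP].
by split=> [E|/eqP//]; exact/eqP.
Qed.

Lemma aff_act_pi a (h : G) :
  aff_act a (\pi_(homspace L) h) = \pi_(homspace L) (a.1 * a.2 h).
Proof.
apply/homspace_eqP; rewrite invgM -mulgA mulKg -lat_aut_funV -autM.
by apply/lat_aut_mem/homspace_eqP; rewrite reprK.
Qed.

Lemma aff_act1 : aff_act 1 =1 id.
Proof. by move=> x; rewrite -[x]reprK aff_act_pi /= mul1g. Qed.

Lemma aff_actM a b : aff_act (a * b) =1 aff_act a \o aff_act b.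
Proof.
move=> x; rewrite -[x]reprK [RHS]/= (aff_act_pi b) !aff_act_pi /=.
by rewrite autM mulgA.
Qed.

Definition left_invariant (R : realType)
    (mu : set (borel_homspace L) -> \bar R) : Prop :=
  forall (g : G) (A : set (borel_homspace L)), measurable A ->
    pushforward mu (aff_act (g, 1) : borel_homspace L -> borel_homspace L) A
    = mu A.

End aff.

Section relative_T.
Variable R : realType.

(** Total variation norm of the signed measure [mu - nu], i.e. the supremum of
    the sums of |mu(A_i) - nu(A_i)| over finite measurable partitions. *)
Definition tv_dist d (T : measurableType d) (mu nu : set T -> \bar R) : \bar R :=
  ereal_sup [set v | exists (k : nat) (A : 'I_k -> set T),
    [/\ forall i, measurable (A i),
        trivIset setT A,
        \bigcup_i A i = setT &
        v = (\sum_(i < k) `|mu (A i) - nu (A i)|)%E]].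

(** The sigma-algebra on [X * X] is the product one; it is the Borel
    sigma-algebra of [X * X] when [X] is a standard Borel space.  Condition 2 is
    bilinear in [phi] and [psi], so real-valued functions suffice. *)
Definition relative_property_T d (X : measurableType d) (mu : probability X R)
    (I : Type) (Gamma : set I) (act : I -> X -> X) : Prop :=
  forall nu : nat -> probability (X * X)%type R,
    (forall n (A : set X), measurable A ->
       pushforward (nu n) fst A = mu A /\ pushforward (nu n) snd A = mu A) ->
    (forall phi psi : X -> R,
       measurable_fun setT phi -> measurable_fun setT psi ->
       (exists M : R, forall x, (`|phi x| <= M)%R) ->
       (exists M : R, forall x, (`|psi x| <= M)%R) ->
       (\int[nu n]_z (phi z.1 * psi z.2)%:E)%E @[n --> \oo] -->
       (\int[mu]_x (phi x * psi x)%:E)%E) ->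
    (forall gamma, Gamma gamma ->
       tv_dist
         (pushforward (nu n) (fun z : X * X => (act gamma z.1, act gamma z.2)))
         (nu n) @[n --> \oo] --> 0%E) ->
    nu n [set z : X * X | z.1 = z.2] @[n --> \oo] --> 1%E.

End relative_T.

Lemma fst_continuous (T U : topologicalType) : continuous (@fst T U).
Proof. by move=> x; exact: cvg_fst. Qed.

Lemma snd_continuous (T U : topologicalType) : continuous (@snd T U).
Proof. by move=> x; exact: cvg_snd. Qed.

Lemma continuous_at_pair (T U V : topologicalType) (f : T -> U) (g : T -> V) x :
  {for x, continuous f} -> {for x, continuous g} ->
  {for x, continuous (fun y => (f y, g y))}.
Proof. by move=> cf cg; exact: (cvg_pair cf cg). Qed.

Definition heis (R : realType) : Type := (R * R * R)%type.

Section heisenberg.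
Variable R : realType.
Local Open Scope ring_scope.

HB.instance Definition _ := Topological.copy (heis R) (R * R * R)%type.

Definition heis1 : heis R := (0, 0, 0).
Definition heisM (g h : heis R) : heis R :=
  let: (x, y, z) := g in let: (x', y', z') := h in
  (x + x', y + y', z + z' + (x * y' - x' * y)).
Definition heisV (g : heis R) : heis R :=
  let: (x, y, z) := g in (- x, - y, - z).

Lemma heisA : associative heisM.
Proof.
by move=> [[x y] z] [[x' y'] z'] [[a b] c]; rewrite /heisM; congr (_, _, _); ring.
Qed.
Lemma heis1M : left_id heis1 heisM.
Proof. by move=> [[x y] z]; rewrite /heisM; congr (_, _, _); ring. Qed.
Lemma heisM1 : right_id heis1 heisM.
Proof. by move=> [[x y] z]; rewrite /heisM; congr (_, _, _); ring. Qed.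
Lemma heisVM : left_inverse heis1 heisV heisM.
Proof. by move=> [[x y] z]; rewrite /heisM; congr (_, _, _); ring. Qed.
Lemma heisMV : right_inverse heis1 heisV heisM.
Proof. by move=> [[x y] z]; rewrite /heisM; congr (_, _, _); ring. Qed.

HB.instance Definition _ := isGroup.Build (heis R)
  heisA heis1M heisM1 heisVM heisMV.

Lemma heis_mul_continuous :
  continuous (fun x : heis R * heis R => (x.1 * x.2)%g).
Proof.
have -> : (fun x : heis R * heis R => (x.1 * x.2)%g) =
  (fun x => (x.1.1.1 + x.2.1.1, x.1.1.2 + x.2.1.2,
    x.1.2 + x.2.2 + (x.1.1.1 * x.2.1.2 - x.2.1.1 * x.1.1.2))).
  by apply/funext => -[[[x y] z] [[x' y'] z']].
suff : continuous (fun x : (R * R * R) * (R * R * R) =>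
  (x.1.1.1 + x.2.1.1, x.1.1.2 + x.2.1.2,
    x.1.2 + x.2.2 + (x.1.1.1 * x.2.1.2 - x.2.1.1 * x.1.1.2))) by [].
move=> p.
have c11 : {for p, continuous (fun x : (R * R * R) * (R * R * R) => x.1.1.1)}.
  by do 2 (apply: continuous_comp; last exact: fst_continuous); exact: fst_continuous.
have c12 : {for p, continuous (fun x : (R * R * R) * (R * R * R) => x.1.1.2)}.
  apply: continuous_comp; last exact: snd_continuous.
  by apply: continuous_comp; exact: fst_continuous.
have c13 : {for p, continuous (fun x : (R * R * R) * (R * R * R) => x.1.2)}.
  by apply: continuous_comp; [exact: fst_continuous|exact: snd_continuous].
have c21 : {for p, continuous (fun x : (R * R * R) * (R * R * R) => x.2.1.1)}.
  apply: continuous_comp; last exact: fst_continuous.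
  by apply: continuous_comp; [exact: snd_continuous|exact: fst_continuous].
have c22 : {for p, continuous (fun x : (R * R * R) * (R * R * R) => x.2.1.2)}.
  apply: continuous_comp; last exact: snd_continuous.
  by apply: continuous_comp; [exact: snd_continuous|exact: fst_continuous].
have c23 : {for p, continuous (fun x : (R * R * R) * (R * R * R) => x.2.2)}.
  by apply: continuous_comp; exact: snd_continuous.
exact: (continuous_at_pair (continuous_at_pair (cvgD c11 c21) (cvgD c12 c22))
  (cvgD (cvgD c13 c23) (cvgB (cvgM c11 c22) (cvgM c21 c12)))).
Qed.

Lemma heis_inv_continuous : continuous (fun x : heis R => (x^-1)%g).
Proof.
have -> : (fun x : heis R => (x^-1)%g) = (fun x => (- x.1.1, - x.1.2, - x.2)).
  by apply/funext => -[[x y] z].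
suff : continuous (fun x : R * R * R => (- x.1.1, - x.1.2, - x.2)) by [].
move=> p.
have c1 : {for p, continuous (fun x : R * R * R => x.1.1)}.
  by apply: continuous_comp; exact: fst_continuous.
have c2 : {for p, continuous (fun x : R * R * R => x.1.2)}.
  by apply: continuous_comp; [exact: fst_continuous|exact: snd_continuous].
have c3 : {for p, continuous (fun x : R * R * R => x.2)}.
  exact: snd_continuous.
exact: (continuous_at_pair (continuous_at_pair (cvgN c1) (cvgN c2)) (cvgN c3)).
Qed.

HB.instance Definition _ := isTopologicalGroup.Build (heis R)
  heis_mul_continuous heis_inv_continuous.

Definition heisZ_set : set (heis R) :=
  [set g | [/\ g.1.1 \is a Num.int, g.1.2 \is a Num.int & g.2 \is a Num.int]].

Lemma heisZ1 : heisZ_set 1%g.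
Proof. by split; exact: rpred0. Qed.
Lemma heisZM g h : heisZ_set g -> heisZ_set h -> heisZ_set (g * h)%g.
Proof.
case: g h => [[x y] z] [[x' y'] z'] [/= gx gy gz] [/= hx hy hz].
split; [exact: rpredD|exact: rpredD|].
by apply: rpredD; [exact: rpredD|apply: rpredB; exact: rpredM].
Qed.
Lemma heisZV g : heisZ_set g -> heisZ_set g^-1%g.
Proof. by case: g => [[x y] z] [/= gx gy gz]; split; rewrite /= rpredN. Qed.

Definition heisZ : subgroup (heis R) := Subgroup heisZ1 heisZM heisZV.

End heisenberg.

(* Main.v *)
Require Import Defs.
From HB Require Import structures.
From mathcomp Require Import all_boot all_order all_algebra.
From mathcomp Require Import all_classical all_reals all_analysis.
From mathcomp Require Import measurable_realfun.
From mathcomp Require Import ring lra.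

(** Let [c_t] be the translation of H_R/H_Z by the central element [(0, 0, t)]
    and let [nu_n] be the mean of the images of [mu] under [x |-> (x, c_t x)] and
    [x |-> (x, c_{-t} x)] with [t = 1/(n+2)].  As [c_t] has no fixed point,
    [nu_n] does not charge the diagonal, although [c_t] tends to the identity.
    An automorphism preserving the lattice acts on the center by [1] or [-1], so
    it maps [c_t] to [c_t] or [c_{-t}]; since moreover it preserves [mu],
    [nu_n] is exactly invariant under the affine group.

    That [mu] is preserved by automorphisms follows from the uniqueness of the
    invariant probability: averaging a function successively over
    [(0, 0, s)], [(0, s, 0)] and [(s, 0, 0)] with [s] in [[0, 1]] keeps its
    integral and yields a constant. *)

Set Implicit Arguments.
Unset Strict Implicit.
Unset Printing Implicit Defensive.

Import Order.TTheory GRing.Theory Num.Theory.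
Import numFieldNormedType.Exports.

Local Open Scope classical_set_scope.
Local Open Scope quotient_scope.
Local Open Scope ring_scope.

(** * Borel sets of homogeneous spaces *)

Notation borel T := (g_sigma_algebraType (@open T)).

Lemma continuous_borel_measurable (T U : ptopologicalType) (f : T -> U) :
  continuous f -> measurable_fun setT (f : borel T -> borel U).
Proof.
move=> /continuousP cf.
apply: (@measurability _ _ _ (borel U) _ _ (@open U : set (set (borel U)))) => //.
by move=> _ [A oA <-]; rewrite setTI; apply: sub_sigma_algebra; exact: cf.
Qed.

(* [U] is a countable union of rectangles whose first side is an interval with
   rational endpoints, even when [T] is not second countable. *)
Lemma open_measurable_prodR (R : realType) (T : ptopologicalType)
    (U : set (R * T)) : open U ->
  measurable (U : set (measurableTypeR R * borel T)%type).
Proof.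
move=> oU.
pose W (p q : rat) : set T :=
  [set x | forall s, ratr p < s < ratr q -> U (s, x)]^°.
have -> : U = \bigcup_p \bigcup_q (`]ratr p, ratr q[%classic `*` W p q).
  apply/seteqP; split=> [[s x] Usx|[s x] [p _ [q _]] [/= +]].
    have [[A B] /= [nA nB] AB] := open_nbhs_nbhs (conj oU Usx).
    have [e /= e0 eA] : exists2 e : R, 0 < e & forall t, `|s - t| < e -> A t.
      by move/nbhs_ballP : nA => [e /= e0 eA]; exists e.
    have [p] := @rat_in_itvoo R (s - e) s ltac:(lra).
    rewrite in_itv /= => /andP[p1 p2].
    have [q] := @rat_in_itvoo R s (s + e) ltac:(lra).
    rewrite in_itv /= => /andP[q1 q2].
    exists p => //; exists q => //; split; first by rewrite /= in_itv /= p2 q1.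
    rewrite /W /interior /=; apply: filterS nB => y By t /andP[pt tq].
    by apply: (AB (t, y)); split => //=; apply: eA; rewrite ltr_norml; lra.
  by rewrite in_itv /= => pq /nbhs_singleton; exact.
apply: bigcupT_measurable_rat => p; apply: bigcupT_measurable_rat => q.
apply: measurableX; first exact: measurable_itv.
by apply: sub_sigma_algebra; exact: open_interior.
Qed.

(** This makes a jointly continuous flow measurable for the product sigma-algebra, as Tonelli's
    theorem demands. *)
Lemma continuous_prodR_measurable (R : realType) (T U : ptopologicalType)
    (f : R * T -> U) : continuous f ->
  measurable_fun setT (f : measurableTypeR R * borel T -> borel U).
Proof.
move=> /continuousP cf.
apply: (@measurability _ _ _ (borel U) _ _ (@open U : set (set (borel U)))) => //.
by move=> _ [A oA <-]; rewrite setTI; apply: open_measurable_prodR; exact: cf.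
Qed.

Section homogeneous_space.
Variables (G : topologicalGroupType) (L : subgroup G).
Local Open Scope group_scope.

Lemma homspace_pi_continuous : continuous (\pi_(homspace L) : G -> homspace L).
Proof. exact: pi_continuous. Qed.

Lemma mulgr_continuous (h : G) : continuous (fun g : G => g * h).
Proof.
move=> g; apply: (continuous_comp (f := fun g : G => (g, h))
  (g := fun x : G * G => x.1 * x.2)); last exact: mulg_continuous.
by apply: continuous_at_pair; [exact: cvg_id|exact: cvg_cst].
Qed.

(** The saturation of [A] is the union of its right translates by [L], each of them open. *)
Lemma homspace_pi_open (A : set G) : open A -> open (\pi_(homspace L) @` A).
Proof.
move=> oA; suff : open (\pi_(homspace L) @^-1` (\pi_(homspace L) @` A)) by [].
have -> : \pi_(homspace L) @^-1` (\pi_(homspace L) @` A) =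
    \bigcup_(l in L) ((fun g => g * l) @^-1` A).
  apply/seteqP; split=> [g [a Aa /esym/homspace_eqP ga]|g [l Ll Agl]].
    by exists (g^-1 * a) => //=; rewrite mulVKg.
  by exists (g * l) => //; apply/esym/homspace_eqP; rewrite mulKg.
apply: bigcup_open => l _.
by move: A oA; apply/continuousP; exact: mulgr_continuous.
Qed.

(** A product of quotient maps need not be a quotient map, so continuity does not simply descend
    from [G * G]. Openness of the projection is used instead: it turns a neighbourhood of a
    representative [h] into one of its coset. *)
Lemma homspace_action_continuous :
  continuous (fun p : G * homspace L => aff_act (p.1, 1 : lat_aut L) p.2).
Proof.
move=> [g x]; rewrite -[x]reprK; set h := repr x; move=> B /=.
rewrite aff_act_pi /= => nB.
have c : continuous (fun p : G * G => \pi_(homspace L) (p.1 * p.2)).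
  move=> p; apply: (continuous_comp (f := fun p : G * G => p.1 * p.2)).
    exact: mulg_continuous.
  exact: homspace_pi_continuous.
have [[A V] /= [nA nV] AV] := c (g, h) B nB.
exists (A, \pi_(homspace L) @` V) => /=.
  split => //; move: nV; rewrite nbhsE => -[V' [oV' V'h] V'V].
  rewrite nbhsE; exists (\pi_(homspace L) @` V').
    by split; [exact: homspace_pi_open|exists h].
  exact: image_subset.
move=> [a _] [/= Aa [v Vv <-]]; rewrite aff_act_pi /=.
exact: (AV (a, v)).
Qed.

Lemma aff_act_continuous (a : aff L) : continuous (aff_act a).
Proof.
apply/quotient_continuous.
have -> : aff_act a \o \pi_(homspace L) =
    \pi_(homspace L) \o (fun g => a.1 * a.2 g).
  by apply/funext => g /=; rewrite aff_act_pi.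
move=> g; apply: continuous_comp; last exact: homspace_pi_continuous.
apply: (continuous_comp (f := fun g : G => (a.1, a.2 g))
  (g := fun x : G * G => x.1 * x.2)); last exact: mulg_continuous.
by apply: continuous_at_pair; [exact: cvg_cst|exact: aut_fun_continuous].
Qed.

Lemma measurable_aff_act (a : aff L) :
  measurable_fun setT (aff_act a : borel_homspace L -> borel_homspace L).
Proof. by apply: continuous_borel_measurable; exact: aff_act_continuous. Qed.

End homogeneous_space.

(** * Averages over one-parameter subgroups *)

Section periodic.
Context (R : realType).
Local Open Scope ereal_scope.
Local Notation mu := (@lebesgue_measure R).

(** Lebesgue measure is determined by its values on half-open intervals, whose lengths a shift
    preserves. *)
Lemma lebesgue_measureDr (b : R) (A : set R) : measurable A ->
  pushforward mu ((fun x => x + b)%R : _ -> measurableTypeR R) A = mu A.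
Proof.
have mD : measurable_fun setT ((fun x => x + b)%R : _ -> measurableTypeR R).
  exact: measurable_funD.
move=> mA; apply/esym.
apply: (@lebesgue_measure_unique _ (pushforward mu _)) => //= _ [[x y]] _ <-.
rewrite /pushforward.
have -> : (fun x => x + b)%R @^-1` [set` `]x, y]] = [set` `](x - b)%R, (y - b)%R]].
  by apply/seteqP; split => t /=; rewrite !in_itv /=; lra.
rewrite !lebesgue_measure_itv/= !lte_fin ltrD2r; case: ifPn => // _.
by rewrite -!EFinB; congr EFin; lra.
Qed.

Lemma ge0_integralDr (b : R) (D : set R) (f : R -> \bar R) :
  measurable D -> measurable_fun setT f -> (forall x, 0 <= f x) ->
  \int[mu]_(x in (fun x => x + b)%R @^-1` D) f (x + b)%R = \int[mu]_(x in D) f x.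
Proof.
move=> mD mf f0.
have mDr : measurable_fun setT ((fun x => x + b)%R : _ -> measurableTypeR R).
  exact: measurable_funD.
rewrite -[LHS](@ge0_integral_pushforward _ _ (measurableTypeR R)
  (measurableTypeR R) _ _ mDr mu D f)//; last exact: measurable_funTS.
by apply: eq_measure_integral => //= A mA AS; exact: lebesgue_measureDr.
Qed.

Lemma integral_period (f : R -> \bar R) (b : R) : measurable_fun setT f ->
  (forall x, 0 <= f x) -> (forall x, f (x + 1)%R = f x) ->
  \int[mu]_(x in `[0%R, 1%R[) f (x + b)%R = \int[mu]_(x in `[0%R, 1%R[) f x.
Proof.
move=> mf f0 f1.
have fz (n : int) x : f (x + n%:~R)%R = f x.
  elim/int_rec : n x => [x|n IH x|n IH x]; first by rewrite addr0.
    by rewrite -[RHS]IH -[RHS]f1; congr f; rewrite intS intrD; ring.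
  by rewrite -[LHS]f1 -[RHS]IH; congr f; rewrite intS !mulrNz intrD; ring.
(* Integers are periods too, so [b] may be replaced by its fractional part. Then [[b, 1 + b[] is cut
   at [1], and its second piece is shifted back to [[0, b[]. *)
wlog b01 : b / (0 <= b < 1)%R.
  move=> H; rewrite -[RHS](H (b - (Num.floor b)%:~R)%R).
    apply: eq_integral => x _; rewrite -[RHS](fz (Num.floor b)).
    by congr f; ring.
  have := floor_itv b; rewrite intrD; lra.
have mI (i : interval R) : measurable [set` i] := measurable_itv i.
transitivity (\int[mu]_(x in `[b, (1 + b)%R[) f x).
  rewrite -[RHS](ge0_integralDr b)//; congr integral.
  by apply/seteqP; split => t /=; rewrite !in_itv /=; lra.
have split3 (x y z : R) : (x <= y <= z)%R -> \int[mu]_(t in `[x, z[) f t =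
    \int[mu]_(t in `[x, y[) f t + \int[mu]_(t in `[y, z[) f t.
  move=> xyz; rewrite -ge0_integral_setU//.
  - congr integral.
    apply/seteqP; split => t /=; rewrite !in_itv /=.
      by case: (ltP t y) => ?; [left|right]; lra.
    by case; lra.
  - exact: measurable_funTS.
  - by apply/disj_setPS => t [] /=; rewrite !in_itv /=; lra.
rewrite (split3 _ 1%R) ?(split3 0%R b 1%R); [|lra|lra].
rewrite addeC; congr (_ + _).
rewrite -[LHS](ge0_integralDr 1)//.
transitivity (\int[mu]_(x in `[0%R, b[) f (x + 1)%R).
  by congr integral; apply/seteqP; split => t /=; rewrite !in_itv /=; lra.
by apply: eq_integral.
Qed.

Lemma integral_uniform_period (f : R -> \bar R) (b : R) :
  measurable_fun setT f ->
  (forall x, 0 <= f x) -> (forall x, f (x + 1)%R = f x) ->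
  \int[uniform_prob (@ltr01 R)]_x f (x + b)%R =
  \int[uniform_prob (@ltr01 R)]_x f x.
Proof.
move=> mf f0 f1.
have mfb : measurable_fun setT (fun x : R => f (x + b)%R).
  apply: (measurableT_comp mf (g := fun x : R => (x + b)%R)).
  exact: measurable_funD.
rewrite !integral_uniform//; congr (_ * _).
(* The uniform law lives on the closed interval; dropping the endpoint [1], a null set, leaves
   exactly one period. *)
rewrite -!integral_itv_bndo_bndc; [|exact: measurable_funTS..].
exact: integral_period.
Qed.

End periodic.

Section averaging.
Context (R : realType) d (T : measurableType d) (P : probability (measurableTypeR R) R).
Variables (mu : probability T R) (phi : R * T -> T).
Hypothesis mphi : measurable_fun setT (phi : measurableTypeR R * T -> T).
Local Open Scope ereal_scope.

Lemma measurable_average (f : T -> \bar R) : measurable_fun setT f ->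
  (forall x, 0 <= f x) -> measurable_fun setT (fun x => \int[P]_s f (phi (s, x))).
Proof.
move=> mf f0.
apply: (@measurable_fun_fubini_tonelli_G _ _ _ _ R P (fun z => f (phi z))) => //.
exact: measurableT_comp.
Qed.

Lemma integral_average (f : T -> \bar R) : measurable_fun setT f ->
  (forall x, 0 <= f x) ->
  (forall s A, measurable A -> mu [set x | A (phi (s, x))] = mu A) ->
  \int[mu]_x \int[P]_s f (phi (s, x)) = \int[mu]_x f x.
Proof.
move=> mf f0 inv.
rewrite -(@fubini_tonelli _ _ _ _ R P mu (fun z => f (phi z))) //; last first.
  exact: measurableT_comp.
(* After the exchange of integrals, the inner one does not depend on [s] by invariance of [mu]; the
   right side is written as the [P]-integral of that constant. *)
rewrite -[RHS]mule1 -(@probability_setT _ _ _ P) -integral_cst//.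
apply: eq_integral => s _.
have ms : measurable_fun setT (fun x => phi (s, x)).
  by apply: measurableT_comp => //; exact: measurable_pair1.
transitivity (\int[pushforward mu (fun x => phi (s, x))]_x f x).
  by rewrite ge0_integral_pushforward.
by apply: eq_measure_integral => //= A mA _; exact: inv.
Qed.

End averaging.

Section translation_average.
Context (R : realType) (G : topologicalGroupType) (L : subgroup G).
Local Open Scope ereal_scope.
Local Notation X := (borel_homspace L).
Local Notation "g • x" := (aff_act (g, 1%g : lat_aut L) (x : homspace L))
  (at level 40).
Local Notation P := (uniform_prob (@ltr01 R)).

Definition average (c : R -> G) (f : X -> \bar R) (x : X) : \bar R :=
  \int[P]_s f (c s • x).

Lemma aff_act_transl_pi (g h : G) :
  g • \pi_(homspace L) h = \pi_(homspace L) (g * h)%g.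
Proof. by rewrite aff_act_pi. Qed.

Lemma aff_act_translM (g h : G) (x : X) : (g * h)%g • x = g • (h • x).
Proof. by rewrite -[RHS]aff_actM; congr aff_act; congr pair; rewrite /= mulg1. Qed.

Variable c : R -> G.
Hypothesis cc : continuous c.

Let act_continuous :
  continuous (fun p : R * homspace L => c p.1 • p.2).
Proof.
move=> p; apply: (continuous_comp (f := fun p : R * homspace L => (c p.1, p.2))
  (g := fun p : G * homspace L => p.1 • p.2)).
  apply: continuous_at_pair; last exact: snd_continuous.
  by apply: continuous_comp; [exact: fst_continuous|exact: cc].
exact: homspace_action_continuous.
Qed.

Let act_measurable : measurable_fun setT
  ((fun p => c p.1 • p.2) : measurableTypeR R * X -> X).
Proof. exact: (continuous_prodR_measurable act_continuous). Qed.

Variables (f : X -> \bar R).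
Hypotheses (mf : measurable_fun setT f) (f0 : forall x, 0 <= f x).

Lemma measurable_fun_average : measurable_fun setT (average c f).
Proof. exact: (measurable_average _ act_measurable mf f0). Qed.

Lemma average_ge0 x : 0 <= average c f x.
Proof. exact: integral_ge0. Qed.

Lemma integral_translation_average (mu : probability X R) : left_invariant mu ->
  \int[mu]_x average c f x = \int[mu]_x f x.
Proof.
move=> inv; apply: (integral_average _ act_measurable mf f0) => s A mA.
exact: (inv (c s) A mA).
Qed.

(** Along the orbit of [x], the function [f (c s • x)] of [s] has period 1 by invariance of [f]
    under [c 1]; translating by [c b] only shifts the window of integration. *)
Lemma average_translation (b : R) (x : X) :
  (forall s t, c (s + t)%R = (c s * c t)%g) ->
  (forall y, f (c 1%R • y) = f y) -> average c f (c b • x) = average c f x.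
Proof.
move=> cD f1; rewrite -[RHS](@integral_uniform_period _ _ b)//.
- by apply: eq_integral => s _; rewrite cD aff_act_translM.
- apply: (measurableT_comp mf (g := fun s : R => (c s • x : X))).
  by apply: (measurableT_comp act_measurable (g := fun s : R => (s, x : X))).
- by move=> s; rewrite addrC cD aff_act_translM.
Qed.

End translation_average.

(** * Uniqueness of the invariant probability on the Heisenberg nilmanifold *)

Section heisenberg.
Context (R : realType).
Local Notation H := (heis R).
Local Notation L := (heisZ R).
Local Notation X := (borel_homspace L).
Local Notation "g • x" := (aff_act (g, 1%g : lat_aut L) (x : homspace L))
  (at level 40).

Definition heis_x (t : R) : H := (t, 0, 0).
Definition heis_y (t : R) : H := (0, t, 0).
Definition heis_z (t : R) : H := (0, 0, t).

Lemma heis_mulE (x y z x' y' z' : R) :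
  (((x, y, z) : H) * ((x', y', z') : H))%g =
  (x + x', y + y', z + z' + (x * y' - x' * y)) :> H.
Proof. by []. Qed.

Lemma heis_xD s t : heis_x (s + t) = (heis_x s * heis_x t)%g.
Proof. by rewrite [RHS]heis_mulE; congr (_, _, _); ring. Qed.

Lemma heis_yD s t : heis_y (s + t) = (heis_y s * heis_y t)%g.
Proof. by rewrite [RHS]heis_mulE; congr (_, _, _); ring. Qed.

Lemma heis_zD s t : heis_z (s + t) = (heis_z s * heis_z t)%g.
Proof. by rewrite [RHS]heis_mulE; congr (_, _, _); ring. Qed.

Lemma heis_z_central t (g : H) : (heis_z t * g = g * heis_z t)%g.
Proof.
by case: g => [[x y] z]; rewrite [LHS]heis_mulE [RHS]heis_mulE; congr (_, _, _); ring.
Qed.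

Lemma heis_x_continuous : continuous heis_x.
Proof.
move=> t; apply: (continuous_at_pair (T := R) (U := (R * R)%type) (V := R)).
  by apply: continuous_at_pair; [exact: cvg_id|exact: cvg_cst].
exact: cvg_cst.
Qed.

Lemma heis_y_continuous : continuous heis_y.
Proof.
move=> t; apply: (continuous_at_pair (T := R) (U := (R * R)%type) (V := R)).
  by apply: continuous_at_pair; [exact: cvg_cst|exact: cvg_id].
exact: cvg_cst.
Qed.

Lemma heis_z_continuous : continuous heis_z.
Proof.
move=> t; apply: (continuous_at_pair (T := R) (U := (R * R)%type) (V := R)).
  exact: cvg_cst.
exact: cvg_id.
Qed.

(** Commutators are central: moving [l] to the right of a representative costs a central factor, and
    the coset then absorbs [l]. *)
Lemma heisZ_translation (l : H) (x : X) : subgroup_set L l ->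
  exists t, l • x = heis_z t • x.
Proof.
move=> Ll; rewrite -[x]reprK; set g := repr _.
have [t lg] : exists t, (l * g = heis_z t * g * l)%g.
  case: l g {Ll} => [[a b] c] [[p q] r].
  (* This is the central coordinate of the commutator of [l] and [g]. *)
  exists (2 * (a * q - p * b)); rewrite [LHS]heis_mulE.
  by rewrite [X in _ = X]heis_mulE; congr (_, _, _); ring.
exists t; rewrite !aff_act_transl_pi lg.
by apply/esym/homspace_eqP; rewrite mulKg.
Qed.

Local Open Scope ereal_scope.

(** The right side does not mention [mu], which is what yields uniqueness. The center must be
    averaged first: lattice elements act as points of the center, so the later averages are periodic
    only on center-invariant functions. *)
Lemma heis_integral_invariant (mu : probability X R) (f : X -> \bar R) :
  left_invariant mu -> measurable_fun setT f -> (forall x, 0 <= f x) ->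
  \int[mu]_x f x =
  average heis_x (average heis_y (average heis_z f)) (\pi_(homspace L) 1%g).
Proof.
move=> inv mf f0.
pose F1 := average heis_z f; pose F2 := average heis_y F1.
pose F3 := average heis_x F2.
have mF1 : measurable_fun setT F1.
  exact: measurable_fun_average heis_z_continuous _ mf f0.
have F10 x : 0 <= F1 x by exact: average_ge0.
have mF2 : measurable_fun setT F2.
  exact: measurable_fun_average heis_y_continuous _ mF1 F10.
have F20 x : 0 <= F2 x by exact: average_ge0.
have IF1 : \int[mu]_x F1 x = \int[mu]_x f x.
  exact: integral_translation_average heis_z_continuous _ mf f0 _ inv.
have IF2 : \int[mu]_x F2 x = \int[mu]_x F1 x.
  exact: integral_translation_average heis_y_continuous _ mF1 F10 _ inv.
have IF3 : \int[mu]_x F3 x = \int[mu]_x F2 x.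
  exact: integral_translation_average heis_x_continuous _ mF2 F20 _ inv.
(* [heis_z 1] is central and in the lattice, hence acts trivially: any [f] is periodic along the
   center. *)
have F1z t x : F1 (heis_z t • x) = F1 x.
  apply: (average_translation heis_z_continuous mf f0) => [|y]; first exact: heis_zD.
  rewrite -[y]reprK aff_act_transl_pi heis_z_central; congr f.
  apply/esym/homspace_eqP; rewrite mulKg.
  by split; rewrite /= ?rpred0 ?rpred1.
have avz c (F : X -> \bar R) : (forall t x, F (heis_z t • x) = F x) ->
    forall t x, average c F (heis_z t • x) = average c F x.
  move=> Fz t x; apply: eq_integral => s _.
  by rewrite -aff_act_translM -heis_z_central aff_act_translM Fz.
have F2z : forall t x, F2 (heis_z t • x) = F2 x by exact: avz.
have F3z : forall t x, F3 (heis_z t • x) = F3 x by exact: avz.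
(* At each point [heis_y 1] acts as some central element, which [F1] does not see. *)
have F2y t x : F2 (heis_y t • x) = F2 x.
  apply: (average_translation heis_y_continuous mF1 F10) => [|y]; first exact: heis_yD.
  have [|s ->] := @heisZ_translation (heis_y 1) y; last exact: F1z.
  by split; rewrite /= ?rpred0 ?rpred1.
have F3x t x : F3 (heis_x t • x) = F3 x.
  apply: (average_translation heis_x_continuous mF2 F20) => [|y]; first exact: heis_xD.
  have [|s ->] := @heisZ_translation (heis_x 1) y; last exact: F2z.
  by split; rewrite /= ?rpred0 ?rpred1.
(* The last average keeps the invariance along [heis_y], since [heis_x s] and [heis_y t] commute up
   to the central element [heis_z (2 * (s * t))]. *)
have F3y t x : F3 (heis_y t • x) = F3 x.
  apply: eq_integral => s _.
  have -> : heis_x s • (heis_y t • x) =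
      heis_z (2 * (s * t)) • (heis_y t • (heis_x s • x)).
    rewrite -!aff_act_translM; congr aff_act; congr pair.
    by rewrite [LHS]heis_mulE [RHS]heis_mulE; congr (_, _, _); ring.
  exact: etrans (F2z _ _) (F2y _ _).
rewrite -IF1 -IF2 -IF3 -/F1 -/F2 -/F3.
clearbody F3; clear -F3x F3y F3z.
rewrite -[RHS]mule1 -(@probability_setT _ _ _ mu) -integral_cst//.
apply: eq_integral => x _; rewrite -[x]reprK; case: (repr _) => [[a b] c].
(* The three subgroups generate the group, so [F3] is constant. The term [a * b] cancels the central
   coordinate [- (a * b)] of [heis_y b * heis_x a]. *)
have -> : ((a, b, c) : H) =
    (heis_z (c + a * b) * heis_y b * heis_x a * 1)%g.
  by rewrite mulg1 [RHS]heis_mulE; congr (_, _, _); ring.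
by rewrite -aff_act_transl_pi !aff_act_translM F3z F3y F3x.
Qed.

Lemma heis_invariant_unique (mu nu : probability X R) :
  left_invariant mu -> left_invariant nu ->
  forall A : set X, measurable A -> mu A = nu A.
Proof.
move=> invmu invnu A mA.
have mf : measurable_fun setT (EFin \o \1_A : X -> \bar R).
  by apply/measurable_EFinP; exact: measurable_indic.
have f0 x : 0 <= (EFin \o \1_A : X -> \bar R) x by rewrite lee_fin.
rewrite -[A]setIT -!integral_indic//.
by rewrite (heis_integral_invariant invmu mf f0) (heis_integral_invariant invnu mf f0).
Qed.

End heisenberg.

(** * Invariance of the measure under the affine group *)

Section aff_invariance.
Context (R : realType).
Local Notation L := (heisZ R).
Local Notation X := (borel_homspace L).

(** Affine maps normalize the translations, so the image of [mu] under [a] is again left invariant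
    and uniqueness applies. *)
Lemma heis_aff_invariant (mu : probability X R) (a : aff L) (A : set X) :
  left_invariant mu -> measurable A -> mu (aff_act a @^-1` A) = mu A.
Proof.
move=> inv mA.
pose ma := isMeasurableFun.Build _ _ _ _ _ (measurable_aff_act a).
pose fa : {mfun X >-> X} := HB.pack (aff_act a : X -> X) ma.
apply: (heis_invariant_unique (mu := distribution mu fa)) => // g B mB.
(* The solution of [(g, 1) * a = a * (g', 1)] in the affine group. *)
pose g' := aut_inv a.2 (a.1^-1 * g * a.1)%g.
rewrite /distribution /pushforward -[RHS](inv g'); last first.
  rewrite -[X in measurable X]setTI; exact: measurable_aff_act.
rewrite /pushforward; congr (mu _); apply/funext => x; congr (B _).
rewrite -[LHS](@aff_actM _ _ (g, _) a) -[RHS](@aff_actM _ _ a); congr aff_act.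
congr pair; rewrite /= ?mul1g ?mulg1// /g' aut_invK.
by rewrite -!mulgA mulVKg.
Qed.

End aff_invariance.

(** * Lattice automorphisms on the center, and fixed points of central translations *)

Section center.
Context (R : realType).
Local Notation H := (heis R).
Local Notation L := (heisZ R).

Lemma heis_centerP (g : H) :
  (forall h : H, g * h = h * g)%g -> exists t, g = heis_z t.
Proof.
case: g => [[x y] z] gC; exists z.
have := gC (heis_x 1); have := gC (heis_y 1).
by rewrite /heis_z !heis_mulE => -[_ _ e1] [_ _ e2]; congr (_, _, _); lra.
Qed.

Lemma lat_aut_heis_z (s : lat_aut L) t : exists u, s (heis_z t) = heis_z u.
Proof.
apply: heis_centerP => h.
by rewrite -[h](aut_invK s) -!autM heis_z_central.
Qed.

(** On the center [s] is an additive map [a s] of the real line. Both [s] and its inverse preserve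
    the lattice, so [a s 1] is a unit of the integers, and additivity carries this over to
    [1 / (n + 1)]. *)
Lemma lat_aut_center (s : lat_aut L) (n : nat) :
  s (heis_z n.+1%:R^-1) = heis_z n.+1%:R^-1 \/
  s (heis_z n.+1%:R^-1) = heis_z (- n.+1%:R^-1).
Proof.
pose a (s : lat_aut L) t : R := (s (heis_z t)).2.
have aE (s' : lat_aut L) t : s' (heis_z t) = heis_z (a s' t).
  by rewrite /a; have [u ->] := lat_aut_heis_z s' t.
have aD (s' : lat_aut L) t u : a s' (t + u) = a s' t + a s' u.
  by rewrite {1}/a heis_zD autM !aE heis_mulE /=; ring.
have a0 (s' : lat_aut L) : a s' 0 = 0 by have := aD s' 0 0; rewrite addr0; lra.
have aMn (s' : lat_aut L) t m : a s' (t *+ m) = a s' t *+ m.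
  by elim: m => [|m IH]; rewrite ?mulr0n ?a0// !mulrS aD IH.
have aMz (s' : lat_aut L) (m : int) : a s' m%:~R = a s' 1 * m%:~R.
  case: m => m; first by rewrite -pmulrn aMn mulr_natr.
  rewrite NegzE mulrNz -pmulrn; have := aD s' (m.+1%:R) (- m.+1%:R).
  by rewrite subrr a0 aMn -mulr_natr mulrN => ?; lra.
have a1 (s' : lat_aut L) : a s' 1 \is a Num.int.
  have : subgroup_set L (s' (heis_z 1)).
    by apply: lat_aut_mem; split; rewrite /= ?rpred0 ?rpred1.
  by case.
have [k sk] := intrP (a1 s); have [m s'm] := intrP (a1 s^-1%g).
(* Evaluate [s] composed with its inverse at [heis_z 1]. *)
have km : k * m = 1.
  apply/eqP; rewrite -(eqr_int R) intrM -sk -aMz -s'm.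
  rewrite /a -aE; have := aut_invK s (heis_z 1).
  by rewrite /a => ->.
have sn : a s n.+1%:R^-1 = k%:~R / n.+1%:R.
  have : a s n.+1%:R^-1 *+ n.+1 = a s 1.
    by rewrite -aMn -(mulr_natr _^-1) mulVf ?pnatr_eq0.
  by rewrite -(mulr_natr (a s _)) sk => <-; rewrite mulfK ?pnatr_eq0.
rewrite aE sn.
have : `|k|%N == 1%N by move/(congr1 absz): km; rewrite abszM => /eqP; rewrite muln_eq1 => /andP[].
by case: k {sk km sn} => [[|[|?]]|[|?]]//= _; [left|right]; rewrite ?mul1r ?mulN1r.
Qed.

(** By centrality, conjugating [heis_z t] by a representative changes nothing, so a fixed coset
    forces [heis_z t] itself into the lattice. *)
Lemma heis_z_fixpoint_free (t : R) (x : homspace L) :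
  aff_act (heis_z t, 1%g : lat_aut L) x = x -> t \is a Num.int.
Proof.
rewrite -[x]reprK aff_act_transl_pi heis_z_central => /esym/homspace_eqP.
by rewrite mulKg => -[].
Qed.

End center.

(** * Transformations converging pointwise to the identity *)

Lemma integrable_bounded_mul (R : realType) d (T : measurableType d)
    (P : probability T R) (f g : T -> R) (M : R) :
  measurable_fun setT f -> measurable_fun setT g ->
  (forall x, `|f x| <= M) -> (forall x, `|g x| <= M) ->
  P.-integrable setT (fun x => (f x * g x)%:E).
Proof.
move=> mf mg fM gM.
apply: (measurable_bounded_integrable (f := fun x => f x * g x)) => //.
- by rewrite (le_lt_trans (probability_le1 _ _))// ltry.
- exact: measurable_funM.
exists (M * M); split; first exact: num_real.
move=> y My x _ /=; apply: le_trans (ltW My).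
by rewrite normrM ler_pM.
Qed.

Section pointwise_to_identity.
Context (R : realType) (T : ptopologicalType) (mu : probability (borel T) R).
Variable f : nat -> borel T -> borel T.
Hypothesis mf : forall n, measurable_fun setT (f n).
Hypothesis mu_f : forall n (A : set (borel T)), measurable A ->
  mu (f n @^-1` A) = mu A.
Hypothesis f_id : forall x : T, (f n x : T) @[n --> \oo] --> x.
Local Open Scope ereal_scope.

(** The mass that [f n] moves out of [A] tends to 0. As [f n] preserves [mu], the mass moved in is
    the same, so this one-sided condition controls the symmetric difference. *)
Let small (A : set (borel T)) := measurable A /\ forall e : R, (0 < e)%R ->
  \forall n \near \oo, mu (A `\` f n @^-1` A) < e%:E.

Let mpre n (A : set (borel T)) : measurable A -> measurable (f n @^-1` A).
Proof. by move=> mA; rewrite -[X in measurable X]setTI; exact: mf. Qed.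

Let cvg0_lt (u : nat -> \bar R) (e : R) : u @ \oo --> 0 -> (0 < e)%R ->
  \forall n \near \oo, u n < e%:E.
Proof.
move=> u0 e0; apply: (u0 [set y | y < e%:E]).
by apply: open_nbhs_nbhs; split; [exact: open_ereal_lt_ereal|rewrite /= lte_fin].
Qed.

Let open_small (U : set T) : open U -> small U.
Proof.
move=> oU; have mU : measurable (U : set (borel T)) by exact: sub_sigma_algebra.
split=> // e e0.
(* Points of [U] that leave [U] at some time from [n] on. These sets decrease, to the empty set by
   pointwise convergence, so continuity from above applies. *)
pose F n := \bigcup_(m in [set m | (n <= m)%N]) (U `\` f m @^-1` U).
have mF n : measurable (F n : set (borel T)).
  by apply: bigcup_measurable => m _; apply: measurableD => //; exact: mpre.
have F0 : \bigcap_n F n = set0.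
  apply/seteqP; split => // x Fx.
  have Ux : U x by have [m _ []] := Fx 0%N I.
  have [N _ NU] := f_id (open_nbhs_nbhs (conj oU Ux)).
  by have [m /= Nm [_]] := Fx N I; apply; exact: NU.
have := @nonincreasing_cvg_mu _ (borel T) R mu F.
rewrite F0 measure0 => /(_ _ mF measurable0 _) cF.
have {cF} : mu \o F @ \oo --> 0.
  apply: cF; first by rewrite (le_lt_trans (probability_le1 _ (mF _)))// ltry.
  move=> n m nm; apply/subsetPset => x [k /= mk Hk].
  by exists k => //=; exact: leq_trans mk.
move=> /cvg0_lt /(_ e0)[N _ NF]; exists N => //= n Nn; apply: le_lt_trans (NF n Nn) => /=.
apply: le_measure; rewrite ?inE//; first by apply: measurableD => //; exact: mpre.
by move=> x Ux; exists n => /=.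
Qed.

Let bigcup_lt (B : nat -> nat -> set (borel T)) (N : nat) :
  (forall i n, measurable (B i n)) ->
  (forall i (e : R), (0 < e)%R -> \forall n \near \oo, mu (B i n) < e%:E) ->
  forall e : R, (0 < e)%R ->
    \forall n \near \oo, mu (\bigcup_(i < N) B i n) < e%:E.
Proof.
move=> mB sB; elim: N => [|N IH] e e0.
  by apply: nearW => n; rewrite II0 bigcup_set0 measure0.
have e20 : (0 < e / 2)%R by rewrite divr_gt0.
apply: filterS2 (IH _ e20) (sB N _ e20) => n H1 H2.
rewrite IIS bigcup_setU bigcup_set1.
apply: le_lt_trans (measureU2 _ _ _) _ => //; first exact: bigcup_measurable.
by rewrite [X in _ < X%:E](splitr e) EFinD lteD.
Qed.

Let smallC (A : set (borel T)) : small A -> small (~` A).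
Proof.
move=> [mA sA]; split; first exact: measurableC.
move=> e e0; apply: filterS (sA e e0) => n; apply: le_lt_trans.
have fin B : measurable B -> mu B \is a fin_num by move=> mB; exact: fin_num_measure.
have -> : ~` A `\` f n @^-1` (~` A) = f n @^-1` A `\` A.
  by rewrite preimage_setC setDE setCK setIC.
have mfA : measurable (f n @^-1` A) by exact: mpre.
have lty B : measurable B -> mu B < +oo.
  by move=> mB; rewrite ltey_eq fin.
rewrite !measureD ?lty// [X in (X - _)%E](mu_f n mA).
by rewrite setIC.
Qed.

Let small_bigcup (A : (set (borel T))^nat) :
  (forall i, small (A i)) -> small (\bigcup_i A i).
Proof.
move=> sA; have mA i : measurable (A i) by case: (sA i).
have mUA : measurable (\bigcup_i A i) by exact: bigcup_measurable.
split=> // e e0; set U := \bigcup_i A i.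
have e20 : (0 < e / 2)%R by rewrite divr_gt0.
pose B N := \bigcup_(i < N) A i.
have mB N : measurable (B N : set (borel T)) by exact: bigcup_measurable.
(* One half of [e] pays for the tail of the union, the other for finitely many sets [A i]. *)
have [N BN] : exists N, mu (U `\` B N) < (e / 2)%:E.
  have := @nonincreasing_cvg_mu _ (borel T) R mu (fun N => U `\` B N).
  have -> : \bigcap_N (U `\` B N) = set0.
    apply/seteqP; split => // x Hx; have [[i _ Aix] _] := Hx 0%N I.
    by have [_] := Hx i.+1 I; apply; exists i => /=.
  rewrite measure0 => H.
  have {H} : mu \o (fun N => U `\` B N) @ \oo --> 0.
    apply: H => [|i||].
    - rewrite (le_lt_trans (probability_le1 _ _)) ?ltry//.
      exact: measurableD.
    - exact: measurableD.
    - exact: measurable0.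
    - move=> n m nm; apply/subsetPset; apply: setDS => x [k /= kn Akx].
      by exists k => //=; exact: leq_trans nm.
  by move=> /cvg0_lt /(_ e20)[N _ NF]; exists N; exact: (NF N (leqnn N)).
have finU : \forall n \near \oo,
    mu (\bigcup_(i < N) (A i `\` f n @^-1` A i)) < (e / 2)%:E.
  apply: bigcup_lt => // [i n|i]; last by case: (sA i).
  by apply: measurableD => //; exact: mpre.
apply: filterS finU => n Hn.
have mD i : measurable (A i `\` f n @^-1` A i).
  by apply: measurableD => //; exact: mpre.
apply: (@le_lt_trans _ _ (mu ((U `\` B N) `|`
    \bigcup_(i < N) (A i `\` f n @^-1` A i)))).
  apply: le_measure; rewrite ?inE.
  - by apply: measurableD => //; exact: mpre.
  - by apply: measurableU; [exact: measurableD|exact: bigcup_measurable].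
  move=> x [Ux nUx]; have [[i /= iN Aix]|nB] := pselect (B N x); last by left.
  by right; exists i => //; split => // Afx; apply: nUx; exists i.
apply: le_lt_trans (measureU2 _ _ _) _; first exact: measurableD.
  exact: bigcup_measurable.
by rewrite [X in _ < X%:E](splitr e) EFinD lteD.
Qed.

(* The sets with this property form a sigma-algebra because [f n] preserves
   [mu], and it contains the open sets by pointwise convergence. *)
Lemma measure_setD_preimage_cvg0 (A : set (borel T)) (e : R) : measurable A ->
  (0 < e)%R -> \forall n \near \oo, mu (A `\` f n @^-1` A) < e%:E.
Proof.
move=> mA; suff : small A by case=> _; exact.
move: A mA; apply: smallest_sub => [|U oU]; last exact: open_small.
split.
- by apply: open_small; exact: open0.
- by move=> A; rewrite setTD; exact: smallC.
- by move=> A sA; exact: small_bigcup.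
Qed.

Lemma integral_comp_cvg (phi psi : borel T -> R) (M : R) :
  measurable_fun setT phi -> measurable_fun setT psi ->
  (forall x, `|phi x| <= M)%R -> (forall x, `|psi x| <= M)%R ->
  \int[mu]_x (phi x * psi (f n x))%:E @[n --> \oo] -->
  \int[mu]_x (phi x * psi x)%:E.
Proof.
move=> mphi mpsi phiM psiM.
wlog M0 : M phiM psiM / (0 < M)%R.
  move=> /(_ (`|M| + 1)%R); apply.
  - by move=> x; have := phiM x; have := ler_norm M; lra.
  - by move=> x; have := psiM x; have := ler_norm M; lra.
  - by rewrite ltr_pwDr.
have mpsif n : measurable_fun setT (fun x => psi (f n x)).
  exact: measurableT_comp.
have intf n : mu.-integrable setT (fun x => (phi x * psi (f n x))%:E).
  exact: (integrable_bounded_mul mu mphi (mpsif n) phiM (fun x => psiM (f n x))).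
have int0 := integrable_bounded_mul mu mphi mpsi phiM psiM.
have fin0 := integrable_fin_num measurableT int0.
have finf n := integrable_fin_num measurableT (intf n).
rewrite -(fineK fin0).
under eq_fun do rewrite -(fineK (finf _)).
apply: cvg_EFin; first exact: nearW.
apply/cvgrPdist_lt => e e0.
(* Outside of [E] below, [x] and [f n x] lie in a common level set [A j], on
   which [psi] varies by at most [d]. *)
pose d := (e / (4 * M))%R.
have d0 : (0 < d)%R by rewrite divr_gt0// mulr_gt0.
have Md : (M * d = e / 4)%R by rewrite /d; field; rewrite gt_eqF.
pose A (j : nat) : set (borel T) :=
  psi @^-1` `[(j%:R * d - M)%R, (j.+1%:R * d - M)%R[.
have mA j : measurable (A j).
  by rewrite -[A j]setTI; apply: mpsi => //; exact: measurable_itv.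
(* The quotient [(psi x + M) / d] lies between 0 and [2 * M / d], and its truncation is the index of
   the level set containing [x]. *)
pose N := (Num.truncn (2 * M / d)).+1.
have cover x : exists2 j, (j < N)%N & A j x.
  have [psiN psiP] : (- M <= psi x /\ psi x <= M)%R.
    by have := psiM x; rewrite ler_norml => /andP[].
  have psid0 : (0 <= (psi x + M) / d)%R by rewrite divr_ge0 ?(ltW d0)//; lra.
  have := truncn_itv psid0; set j := Num.truncn _ => /andP[j1 j2].
  exists j; first by rewrite /N ltnS; apply: le_truncn; rewrite ler_pM2r ?invr_gt0//; lra.
  rewrite /A /= in_itv /=; move: j1 j2.
  by rewrite ler_pdivlMr// ltr_pdivrMr// => j1 j2; apply/andP; split; lra.
(* The integrand is at most [2 * M * M] on [E] and at most [M * d = e / 4] elsewhere; with this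
   bound on [mu E] the total stays below [e / 2]. *)
pose e' := (e / (8 * M * M))%R.
have e'0 : (0 < e')%R by rewrite divr_gt0// !mulr_gt0.
have mD j n : measurable (A j `\` f n @^-1` A j).
  by apply: measurableD => //; exact: mpre.
have := bigcup_lt N mD
  (fun j e => @measure_setD_preimage_cvg0 (A j) e (mA j)) e'0.
apply: filterS => n; set E := \bigcup_(i < N) _ => En.
have mE : measurable E by exact: bigcup_measurable.
rewrite -lte_fin -abse_EFin EFinB !fineK//.
rewrite -(integralB_EFin measurableT int0 (intf n)).
apply: le_lt_trans (le_abse_integral _ measurableT _) _.
  by apply: emeasurable_funB; [exact: measurable_int int0|exact: measurable_int (intf n)].
have m1E : measurable_fun setT (fun x : borel T => (\1_E x : R)%:E).
  by apply/measurable_EFinP; exact: measurable_indic.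
apply: (@le_lt_trans _ _
    (\int[mu]_x ((M * d)%:E + (2 * M * M)%:E * (\1_E x)%:E))).
  apply: ge0_le_integral => //.
  - apply: measurableT_comp => //.
    by apply: emeasurable_funB; [exact: measurable_int int0|exact: measurable_int (intf n)].
  - by apply: emeasurable_funD => //; exact: measurable_funeM.
  move=> x _; rewrite -EFinB abse_EFin -EFinM -EFinD lee_fin -mulrBr normrM.
  rewrite indicE; have [Ex|nEx] := pselect (E x).
    rewrite mem_set// mulr1 Md; apply: (@le_trans _ _ (M * (2 * M))%R); last by lra.
    rewrite ler_pM//; apply: le_trans (ler_normB _ _) _.
    by have := psiM x; have := psiM (f n x); lra.
  rewrite memNset// mulr0 addr0 ler_pM//.
  have [j jN Ajx] := cover x.
  have Ajfx : A j (f n x).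
    by apply: contrapT => nA; apply: nEx; exists j.
  move: Ajx Ajfx; rewrite /A /= !in_itv /= -(@natr1 R j) => /andP[? ?] /andP[? ?].
  by rewrite ler_norml; lra.
rewrite ge0_integralD//; last 3 first.
- by move=> x _; rewrite lee_fin Md divr_ge0// ltW.
- by move=> x _; rewrite mule_ge0// lee_fin// !mulr_ge0// ltW.
- exact: measurable_funeM.
rewrite integral_cst// [X in _ * X + _]probability_setT mule1 ge0_integralZl//; last first.
  by rewrite lee_fin !mulr_ge0// ltW.
rewrite integral_indic// setIT.
have [r Er] : exists r, mu E = r%:E.
  by exists (fine (mu E)); rewrite fineK// fin_num_measure.
move: En; rewrite Er lte_fin ltr_pdivlMr ?mulr_gt0// => En.
rewrite [X in _ + _ * X]Er -EFinM -EFinD lte_fin Md.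
by lra.
Qed.

End pointwise_to_identity.

(** * The measures on the square *)

Section tv_dist.
Local Open Scope ereal_scope.

Lemma tv_dist_eq0 (R : realType) d (T : measurableType d) (m : set T -> \bar R)
    (P : probability T R) :
  (forall A, measurable A -> m A = P A) -> tv_dist m P = 0.
Proof.
move=> mP; rewrite /tv_dist.
rewrite [X in ereal_sup X](_ : _ = [set 0]); first exact: ereal_sup1.
have sum0 k (A : 'I_k -> set T) : (forall i, measurable (A i)) ->
    \sum_(i < k) `|m (A i) - P (A i)| = 0.
  by move=> mA; apply: big1 => i _; rewrite mP// subee ?abse0// fin_num_measure.
apply/seteqP; split => [_ [k [A [mA _ _ ->]]]|_ ->]; first exact: sum0.
(* The one-block partition shows that the supremum is not taken over the empty set. *)
exists 1%N, (fun=> setT); split => //; last by rewrite sum0.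
  by move=> i j _ _ _; rewrite !ord1.
by rewrite bigcup_const//; exists ord0.
Qed.

End tv_dist.

Section mixture.
Context (R : realType) d (T : measurableType d) (P Q : probability T R).
Let half : {nonneg R} := (2^-1 : R)%:nng.
Local Open Scope ereal_scope.

Definition mixture : set T -> \bar R :=
  mscale half (measure_add P Q).

HB.instance Definition _ := Measure.on mixture.

Lemma mixtureE A : mixture A = (2^-1)%R%:E * (P A + Q A).
Proof. by rewrite /mixture /mscale; congr (_ * _); exact: measure_addE. Qed.

Let mixture_setT : mixture setT = 1.
Proof.
rewrite mixtureE [P _]probability_setT [Q _]probability_setT -EFinD -EFinM.
by congr EFin; lra.
Qed.

HB.instance Definition _ := Measure_isProbability.Build _ _ _ mixture mixture_setT.

(** Linearity in the measure holds for nonnegative functions; integrability makes the positive and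
    negative parts finite, so that they may be regrouped. *)
Lemma integral_mixture (f : T -> \bar R) :
  P.-integrable setT f -> Q.-integrable setT f ->
  \int[mixture]_x f x = (2^-1)%R%:E * (\int[P]_x f x + \int[Q]_x f x).
Proof.
move=> iP iQ; have mf := measurable_int _ iP.
have part g : measurable_fun setT g -> (forall x, 0 <= g x) ->
    \int[mixture]_x g x = (2^-1)%R%:E * (\int[P]_x g x + \int[Q]_x g x).
  by move=> mg g0; rewrite ge0_integral_mscale//= ge0_integral_measure_add.
have mp : measurable_fun setT f^\+ by exact: measurable_funepos.
have mn : measurable_fun setT f^\- by exact: measurable_funeneg.
rewrite [LHS]integralE !part// (integralE P _ f) (integralE Q _ f).
have := integrable_pos_fin_num measurableT iP.
have := integrable_pos_fin_num measurableT iQ.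
have := integrable_neg_fin_num measurableT iP.
have := integrable_neg_fin_num measurableT iQ.
move=> /fineK <- /fineK <- /fineK <- /fineK <-.
by rewrite -!EFinN -!EFinD -!EFinM; congr EFin; ring.
Qed.

End mixture.

Section graph.
Context (R : realType) d (T : measurableType d) (mu : probability T R).
Variables (f : T -> T) (mf : measurable_fun setT f).

Lemma measurable_fun_graph : measurable_fun setT (fun x => (x, f x)).
Proof. by apply: measurable_fun_pair => //; exact: measurable_id. Qed.

Let graph_mfun : {mfun T >-> (T * T)%type} :=
  HB.pack (fun x => (x, f x)) (isMeasurableFun.Build _ _ _ _ _ measurable_fun_graph).

(** The coupling of [mu] with its image under [f] carried by the graph of [f]; both marginals are
    [mu] when [f] preserves it. *)
Definition graph_measure : probability (T * T)%type R := distribution mu graph_mfun.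

Local Open Scope ereal_scope.

Lemma integral_graph_measure (g : T * T -> \bar R) : measurable_fun setT g ->
  mu.-integrable setT (fun x => g (x, f x)) ->
  graph_measure.-integrable setT g /\
  \int[graph_measure]_z g z = \int[mu]_x g (x, f x).
Proof.
move=> mg ig; split.
  exact: (integrable_pushforward measurable_fun_graph mg).
exact: (integral_pushforward measurable_fun_graph mg).
Qed.

End graph.

(** * Central translations and their conjugation by affine maps *)

Section central_rotation.
Context (R : realType).
Local Notation L := (heisZ R).
Local Notation X := (borel_homspace L).

Definition rotate (t : R) : X -> X := aff_act (heis_z t, 1%g : lat_aut L).

Lemma measurable_rotate t : measurable_fun setT (rotate t).
Proof. exact: measurable_aff_act. Qed.

Lemma rotate_cvg (u : nat -> R) (x : homspace L) : u n @[n --> \oo] --> 0 ->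
  (rotate (u n) x : homspace L) @[n --> \oo] --> x.
Proof.
move=> u0.
have c : continuous (fun t : R => aff_act (heis_z t, 1%g : lat_aut L) x).
  move=> t; apply: (continuous_comp (f := fun t : R => (heis_z t, x))
    (g := fun p : heis R * homspace L => aff_act (p.1, 1%g : lat_aut L) p.2)).
    by apply: continuous_at_pair; [exact: heis_z_continuous|exact: cvg_cst].
  exact: homspace_action_continuous.
rewrite -[x in X in _ --> X](_ : aff_act (heis_z 0, 1%g : lat_aut L) x = x); last first.
  exact: (@aff_act1 _ L).
exact: (continuous_cvg _ (c 0) u0).
Qed.

(** The translation part of [a] commutes with the center and the automorphism part fixes or inverts
    [heis_z]. The pair of opposite rotations is thus preserved or swapped, which is why [nu] below
    is a symmetric mean. *)
Lemma aff_act_rotate (a : aff L) (n : nat) :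
  (forall x, aff_act a (rotate n.+1%:R^-1 x) = rotate n.+1%:R^-1 (aff_act a x) /\
    aff_act a (rotate (- n.+1%:R^-1) x) = rotate (- n.+1%:R^-1) (aff_act a x)) \/
  (forall x, aff_act a (rotate n.+1%:R^-1 x) = rotate (- n.+1%:R^-1) (aff_act a x) /\
    aff_act a (rotate (- n.+1%:R^-1) x) = rotate n.+1%:R^-1 (aff_act a x)).
Proof.
have comm t u x : a.2 (heis_z t) = heis_z u ->
    aff_act a (rotate t x) = rotate u (aff_act a x).
  move=> atu; rewrite /rotate -[LHS]aff_actM -[RHS]aff_actM; congr aff_act.
  by congr pair; rewrite /= ?mulg1 ?mul1g// atu heis_z_central.
have zV t : heis_z (- t) = (heis_z t)^-1%g :> heis R.
  by rewrite /heis_z; congr (_, _, _); rewrite oppr0.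
have [E|E] := lat_aut_center a.2 n; [left|right] => x; split; apply: comm => //.
  by rewrite !zV lat_aut_funV E.
by rewrite zV lat_aut_funV E zV invgK.
Qed.

End central_rotation.

Theorem corollary4p1 (R : realType) (Gamma : subgroup (aff (heisZ R)))
    (Gamma_countable : countable Gamma)
    (mu : probability (borel_homspace (heisZ R)) R)
    (mu_invariant : left_invariant mu) :
  ~ relative_property_T mu Gamma (@aff_act (heis R) (heisZ R)).
Proof.
set X := borel_homspace (heisZ R).
(* Starting at [1 / 2] keeps every [u n] strictly between 0 and 1, hence never an integer. *)
pose u (n : nat) : R := n.+2%:R^-1.
pose graph t := graph_measure mu (@measurable_rotate R t).
pose nu n : probability (X * X)%type R := mixture (graph (u n)) (graph (- u n)).
have nuE n A : nu n A = ((2^-1)%R%:E * (mu [set x | A (x, rotate (u n) x)] +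
    mu [set x | A (x, rotate (- u n) x)]))%E by exact: mixtureE.
have half (x y : \bar R) : x \is a fin_num -> x = y -> ((2^-1)%R%:E * (x + y) = x)%E.
  move=> /fineK <- <-; rewrite -EFinD -EFinM; congr EFin.
  by lra.
have inv t (A : set X) : measurable A -> mu (rotate t @^-1` A) = mu A.
  by move=> mA; exact: heis_aff_invariant.
move=> /(_ nu) T.
have u0 : u n @[n --> \oo] --> 0.
  by have := @cvg_harmonic R; rewrite -cvg_shiftS.
have Nu0 : - u n @[n --> \oo] --> 0 by rewrite -[0]oppr0; exact: cvgN.
have nu_diag n : nu n [set z : X * X | z.1 = z.2] = 0%E.
  have uZ : u n \isn't a Num.int.
    apply/negP => /intrP [k uk].
    have : 0 < u n < 1 by rewrite invr_gt0 ltr0n invf_lt1 ?ltr0n// ltr1n.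
    by rewrite uk ltr0z (ltr_int R k 1); case: k {uk} => [[|k]|k].
  rewrite nuE.
  have fixE t : t \isn't a Num.int -> [set x : X | x = rotate t x] = set0.
    move=> tZ; apply/seteqP; split => // x /= /esym /heis_z_fixpoint_free.
    by rewrite (negbTE tZ).
  by rewrite /= !fixE ?rpredN// measure0 adde0 mule0.
have : nu n [set z : X * X | z.1 = z.2] @[n --> \oo] --> 1%E.
  apply: T.
  - move=> n A mA; split.
      by rewrite /pushforward nuE half// fin_num_measure.
    rewrite /pushforward nuE half.
    + exact: (inv _ _ mA).
    + by rewrite [X in X \is a fin_num](inv _ _ mA) fin_num_measure.
    + exact: etrans (inv _ _ mA) (esym (inv _ _ mA)).
  - move=> phi psi mphi mpsi [M1 phiM] [M2 psiM].
    pose M := Num.max M1 M2.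
    have {}phiM x : `|phi x| <= M by rewrite le_max phiM.
    have {}psiM x : `|psi x| <= M by rewrite le_max psiM orbT.
    have mh : measurable_fun setT (fun z : X * X => (phi z.1 * psi z.2)%:E).
      apply/measurable_EFinP; apply: measurable_funM.
        exact: measurableT_comp mphi measurable_fst.
      exact: measurableT_comp mpsi measurable_snd.
    have ig t := @integral_graph_measure R _ X mu _ (@measurable_rotate R t) _ mh
      (integrable_bounded_mul mu mphi
        (measurableT_comp mpsi (@measurable_rotate R t)) phiM
        (fun x => psiM (rotate t x))).
    have lim t : t n @[n --> \oo] --> 0 ->
        (\int[mu]_x (phi x * psi (rotate (t n) x))%:E)%E @[n --> \oo] -->
        (\int[mu]_x (phi x * psi x)%:E)%E.
      move=> t0; apply: (integral_comp_cvg (f := fun n => rotate (t n)) _ _ _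
        mphi mpsi phiM psiM).
      + by move=> n; exact: measurable_rotate.
      + by move=> n A mA; exact: inv.
      + by move=> x; exact: rotate_cvg.
    have fin := integrable_fin_num measurableT
      (integrable_bounded_mul mu mphi mpsi phiM psiM).
    (* The limit is written as the half-sum of two copies of itself, one for each rotation. *)
    rewrite -[X in _ --> X](half _ _ fin erefl).
    have E n : (\int[nu n]_z (phi z.1 * psi z.2)%:E = (2^-1)%R%:E *
        (\int[mu]_x (phi x * psi (rotate (u n) x))%:E +
         \int[mu]_x (phi x * psi (rotate (- u n) x))%:E))%E.
      rewrite integral_mixture ?(ig _).1//; congr (_ * (_ + _))%E; exact: (ig _).2.
    under eq_fun do rewrite E.
    apply: cvgeZl => //; apply: cvgeD; [|exact: lim|exact: lim].
    by rewrite fin_num_adde_defl.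
  - move=> a _; apply: cvg_near_cst; apply: nearW => n.
    apply: tv_dist_eq0 => A mA; rewrite /pushforward !nuE.
    have E t : mu [set x | A (aff_act a x, rotate t (aff_act a x))] =
        mu [set x | A (x, rotate t x)].
      apply: (heis_aff_invariant a (A := [set x | A (x, rotate t x)])) => //.
      rewrite -[X in measurable X]setTI.
      exact: (measurable_fun_graph (@measurable_rotate R t)).
    (* The index is [n.+1] because [u n] is the inverse of [n.+2]. Invariance of [mu] inserts [a] in
       both terms; in the second case the two terms are exchanged. *)
    have [H|H] := aff_act_rotate a n.+1; rewrite -2!E.
      by congr (_ * (mu _ + mu _))%E; apply/funext => x; rewrite /= -?(H x).1 -?(H x).2.
    by rewrite addeC; congr (_ * (mu _ + mu _))%E; apply/funext => x;
      rewrite /= -?(H x).1 -?(H x).2.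
(* The masses of the diagonal are constantly 0, yet would have to tend to 1. *)
under eq_fun do rewrite nu_diag.
move=> /(cvg_lim (@ereal_hausdorff R)); rewrite lim_cst// => -[] /eqP.
by rewrite eq_sym oner_eq0.
Qed.
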